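(* Let $\mathcal C=(F_v,F_e,\mathcal T)$ be a crystal framework in $\mathbb R^d$ with separable space group $\mathcal G(\mathcal C)$, motif $\mathcal M=(F_v,F_e)$ and point group $\mathcal G_{\rm pt}(\mathcal C)$. Then $$\dot\pi_e(\dot g)R(\mathcal M,\mathbb R^{d^2})=R(\mathcal M,\mathbb R^{d^2})\dot\pi_v(\dot g),\quad \dot g\in\mathcal G_{\rm pt}(\mathcal C).$$ Moreover, for a fixed element $\dot g\in\mathcal G_{\rm pt}(\mathcal C)$ the individual symmetry equation $$\dot\pi_e(\dot g)R(\mathcal M,\mathcal E)=R(\mathcal M,\mathcal E)\dot\pi_v(\dot g)$$ holds, where $\mathcal E$ is any linear space of $d\times d$ matrices which is invariant under the map $A\mapsto T_{\dot g}AT_{\dot g}^{-1}$.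
   Context: A full rank translation group on $\mathbb R^d$ is a set $\mathcal T=\{T_k:k\in\mathbb Z^d\}$ of translations with $T_{k+l}=T_kT_l$ whose period vectors $a_i=T_{\gamma_i}0$ ($\gamma_1,\dots,\gamma_d$ the standard basis) are linearly independent. $Z$ is the invertible matrix with $Z\gamma_i=a_i$, so $T_kx=x+Zk$. A crystal framework $\mathcal C=(F_v,F_e,\mathcal T)$ in $\mathbb R^d$ is a countable bar-joint framework (framework points in $\mathbb R^d$ together with framework edges, which are line segments of positive length joining certain pairs of framework points) whose framework points are $p_{\kappa,k}=T_kp_{\kappa,0}$, $1\le\kappa\le t$, $k\in\mathbb Z^d$, such that $F_v=\{p_{\kappa,0}\}$, $F_e$ is a finite set of framework edges, the set of framework points is the disjoint union of the $T_k(F_v)$ and the set of framework edges is the disjoint union of the $T_k(F_e)$. A motif edge is written $e=[p_{\kappa,l},p_{\tau,l'}]$ with edge vector $v_e=p_{\kappa,l}-p_{\tau,l'}$ and exponent $\delta(e)=l'-l=(\delta_1,\dots,\delta_d)$. The matrix $R(\mathcal M,\mathbb R^{d^2})$ is the $|F_e|\times(d|F_v|+d^2)$ matrix whose row for $e$ has $v_e$ in the $d$ columns for $\kappa$, $-v_e$ in the $d$ columns for $\tau$ (zero in these columns if $\kappa=\tau$), zeros in the other vertex columns, and $(\delta_1v_e,\dots,\delta_dv_e)$ in the last $d^2$ columns. Vector-matrix data $(u,A)$, $u\in\mathbb R^{d|F_v|}$, $A\in M_d(\mathbb R)$, is identified with the vector $(u,AZ)$ in the domain of $R(\mathcal M,\mathbb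 R^{d^2})$, with $AZ$ written as its $d$ columns in order; so $R(\mathcal M,\mathbb R^{d^2})$ acts by $(u,A)\mapsto R(\mathcal M,\mathbb R^{d^2})(u,AZ)$, and $R(\mathcal M,\mathcal E)$ is its restriction to pairs $(u,A)$ with $A\in\mathcal E$. The space group $\mathcal G(\mathcal C)$ is the group of isometries $T_g$ of $\mathbb R^d$ mapping $\mathcal C$ to itself, viewed abstractly; it acts on vertex labels by $p_{g\cdot(\kappa,k)}=T_g(p_{\kappa,k})$ and correspondingly on edges. Here $\mathcal T$ is a maximal translation subgroup, and the point group is the quotient $\mathcal G_{\rm pt}(\mathcal C)=\mathcal G(\mathcal C)/\mathcal T$, with $\dot g$ the coset of $g$. The space group is separable if every $g$ acts by $g\cdot(\kappa,k)=(g\cdot\kappa,g\cdot k)$ for group actions $\kappa\mapsto g\cdot\kappa$ on the motif vertices and $k\mapsto g\cdot k$ on $\mathbb Z^d$. In this case the elements with $g\cdot 0=0$ (those for which $T_g$ permutes $F_v$) form a complement to the translations, giving an inclusion $i:\mathcal G_{\rm pt}(\mathcal C)\to\mathcal G(\mathcal C)$, and the origin of $\mathbb R^d$ is chosen (by an appropriate shift of $\mathcal C$) so that $\dot g\mapsto T_{\dot g}:=T_{i(\dot g)}$ is a representation by linear isometries. $\dot\pi_v(\dot g)(u,A)=(\mu_v(\dot g)u,\ T_{\dot g}AT_{\dot g}^{-1})$, where $(\mu_v(\dot g)u)_\kappa=T_{\dot g}u_{g^{-1}\cdot\kappa}$ with $g=i(\dot g)$. $\dot\pi_e(\dot g)$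 is the edge class permutation representation on $\mathbb R^{|F_e|}$: $(\dot\pi_e(\dot g)w)_f=w_{g^{-1}\cdot f}$, where $g$ acts on $F_e$ identified with the set of $\mathcal T$-translation classes of framework edges. *)

(* Defs.v *)
From HB Require Import structures.
From mathcomp Require Import all_boot all_order all_algebra.
From mathcomp Require Import boolp classical_sets reals.

Set Implicit Arguments.
Unset Strict Implicit.
Unset Printing Implicit Defensive.

Import Order.TTheory GRing.Theory Num.Theory.

Local Open Scope classical_set_scope.
Local Open Scope ring_scope.

Section Euclidean.
Variables (R : realType) (d : nat).
Implicit Types (x y : 'cV[R]_d) (f : 'cV[R]_d -> 'cV[R]_d).

Definition dot x y : R := (x^T *m y) 0 0.

(* The Euclidean distance; the library's norm on matrices is the sup norm. *)
Definition dist x y : R := Num.sqrt (dot (x - y) (x - y)).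

(* Every distance-preserving self-map of a Euclidean space is onto; requiring
   it here makes the inverse of a symmetry immediate. *)
Definition isometry f : Prop :=
  (forall x y, dist (f x) (f y) = dist x y) /\ (forall y, exists x, f x = y).

Definition segment x y : set 'cV[R]_d :=
  [set z | exists s : R, 0 <= s <= 1 /\ z = (1 - s) *: x + s *: y].

Definition is_translation f : Prop := exists b, forall x, f x = x + b.

(* The matrix of f in the standard basis, meaningful when f is linear. *)
Definition mx_of f : 'M[R]_d := \matrix_(r, c) f (delta_mx c 0) r 0.

End Euclidean.

Record translation_group (R : realType) (d : nat) := TranslationGroup {
  tr :> 'cV[int]_d -> 'cV[R]_d -> 'cV[R]_d;
  tr_translation : forall k, is_translation (tr k);
  trD : forall k l, tr (k + l) = tr k \o tr l;
  tr_full_rank : free [seq tr (delta_mx i 0) 0 | i : 'I_d]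
}.

Definition period_mx (R : realType) (d : nat) (T : translation_group R d) :
    'M[R]_d :=
  \matrix_(r, c) T (delta_mx c 0) 0 r 0.

(* The motif vertices are indexed by 'I_nv and the motif edges by 'I_ne.  A
   motif edge is recorded by the labels ((kappa, l), (tau, l')) of its
   endpoints, the order being that used in v_e and delta(e).  The two
   injectivity conditions say that F_v and F_e are listed without repetition
   and that their translates are pairwise disjoint. *)
Record crystal_framework (R : realType) (d : nat) := CrystalFramework {
  nv : nat;
  ne : nat;
  trans : translation_group R d;
  motif_pt : 'I_nv -> 'cV[R]_d;
  motif_edge : 'I_ne -> ('I_nv * 'cV[int]_d) * ('I_nv * 'cV[int]_d);
  points_disjoint :
    injective (fun v : 'I_nv * 'cV[int]_d => trans v.2 (motif_pt v.1));
  edge_pos_length : forall e, (motif_edge e).1 != (motif_edge e).2;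
  edges_disjoint :
    injective (fun ek : 'I_ne * 'cV[int]_d =>
      let p (v : 'I_nv * 'cV[int]_d) := trans v.2 (motif_pt v.1) in
      trans ek.2 @` segment (p (motif_edge ek.1).1) (p (motif_edge ek.1).2))
}.

Section Framework.
Variables (R : realType) (d : nat) (C : crystal_framework R d).

Definition label : Type := 'I_(nv C) * 'cV[int]_d.

Definition pt (v : label) : 'cV[R]_d := trans C v.2 (motif_pt v.1).

Definition motif_segment (e : 'I_(ne C)) : set 'cV[R]_d :=
  segment (pt (motif_edge e).1) (pt (motif_edge e).2).

Definition framework_points : set 'cV[R]_d := range pt.

Definition framework_edges : set (set 'cV[R]_d) :=
  [set s | exists k e, s = trans C k @` motif_segment e].

Definition is_symmetry (f : 'cV[R]_d -> 'cV[R]_d) : Prop :=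
  [/\ isometry f,
      f @` framework_points = framework_points &
      [set f @` s | s in framework_edges] = framework_edges].

Definition symmetry_pred : pred ('cV[R]_d -> 'cV[R]_d) :=
  fun f => `[< is_symmetry f >].

Record space_group := SpaceGroup {
  iso :> 'cV[R]_d -> 'cV[R]_d;
  isoP : symmetry_pred iso
}.

HB.instance Definition _ := [isSub for iso].
HB.instance Definition _ := [Choice of space_group by <:].

Lemma is_symmetry_id : is_symmetry id.
Proof.
split; last 2 first.
- by rewrite image_id.
- by under eq_imagel do rewrite image_id; rewrite image_id.
by split=> // y; exists y.
Qed.

Lemma is_symmetry_comp f g :
  is_symmetry f -> is_symmetry g -> is_symmetry (f \o g).
Proof.
move=> [[fd fs] fp fe] [[gd gs] gp ge]; split.
- split=> [x y|y]; first by rewrite /= fd gd.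
  by have [z <-] := fs y; have [x <-] := gs z; exists x.
- by rewrite -image_comp gp fp.
rewrite -[RHS]fe -[in RHS]ge image_comp.
by apply: eq_imagel => s _; rewrite /= image_comp.
Qed.

Definition inverse (f : 'cV[R]_d -> 'cV[R]_d) (y : 'cV[R]_d) : 'cV[R]_d :=
  xget 0 [set x | f x = y].

Lemma isometry_inj (f : 'cV[R]_d -> 'cV[R]_d) : isometry f -> injective f.
Proof.
move=> [fd _] x y fxy; apply/eqP; rewrite -subr_eq0; apply/eqP.
have dot_ge0 (z : 'cV[R]_d) : 0 <= dot z z.
  by rewrite /dot mxE; apply: sumr_ge0 => i _; rewrite mxE -expr2 sqr_ge0.
have: dist x y = 0.
  by rewrite -fd fxy /dist subrr /dot mulmx0 mxE sqrtr0.
move=> /eqP; rewrite /dist sqrtr_eq0 => le0.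
have: dot (x - y) (x - y) == 0 by rewrite eq_le le0 dot_ge0.
rewrite /dot mxE psumr_eq0; last first.
  by move=> i _; rewrite mxE -expr2 sqr_ge0.
move=> /allP z0; apply/colP => i.
have := z0 i (mem_index_enum i).
by rewrite mxE -expr2 sqrf_eq0 => /eqP->; rewrite mxE.
Qed.

Lemma inverseK f : isometry f -> cancel (inverse f) f.
Proof. by move=> [_ fs] y; apply: (xgetPex 0 (fs y)). Qed.

Lemma inverseKV f : isometry f -> cancel f (inverse f).
Proof. by move=> fi x; apply: (isometry_inj fi); rewrite inverseK. Qed.

Lemma is_symmetry_inv f : is_symmetry f -> is_symmetry (inverse f).
Proof.
move=> [fi fp fe]; have fK := inverseK fi; have fVK := inverseKV fi.
have imK s : inverse f @` (f @` s) = s.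
  by rewrite image_comp (_ : _ \o _ = id) ?image_id//; apply/funext.
split; [split=> [x y|y]| |].
- by rewrite -fi.1 !fK.
- by exists (f y).
- by rewrite -[in LHS]fp imK.
rewrite -[in LHS]fe image_comp -[RHS]image_id.
by apply: eq_imagel => s _ /=; rewrite imK.
Qed.

Definition sg_one : space_group := SpaceGroup (asboolT is_symmetry_id).
Definition sg_mul (g h : space_group) : space_group :=
  SpaceGroup (asboolT
    (is_symmetry_comp (asboolW (isoP g)) (asboolW (isoP h)))).
Definition sg_inv (g : space_group) : space_group :=
  SpaceGroup (asboolT (is_symmetry_inv (asboolW (isoP g)))).

Lemma sg_mulA : associative sg_mul. Proof. by move=> *; apply/val_inj. Qed.
Lemma sg_mul1 : left_id sg_one sg_mul. Proof. by move=> *; apply/val_inj. Qed.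
Lemma sg_mulr1 : right_id sg_one sg_mul. Proof. by move=> *; apply/val_inj. Qed.

Lemma sg_mulV : left_inverse sg_one sg_inv sg_mul.
Proof.
move=> g; apply/val_inj/funext => x.
by have [gi _ _] := asboolW (isoP g); apply: inverseKV.
Qed.

Lemma sg_mulrV : right_inverse sg_one sg_inv sg_mul.
Proof.
move=> g; apply/val_inj/funext => x.
by have [gi _ _] := asboolW (isoP g); apply: inverseK.
Qed.

HB.instance Definition _ :=
  isGroup.Build space_group sg_mulA sg_mul1 sg_mulr1 sg_mulV sg_mulrV.

Definition translations : set space_group :=
  [set g | exists k, iso g = trans C k].

Definition translation_subgroup (H : set space_group) : Prop :=
  [/\ H 1%g,
      forall g h, H g -> H h -> H (g * h)%g,
      forall g, H g -> H (g^-1)%g &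
      forall g, H g -> is_translation g].

Definition maximal_translations : Prop :=
  forall H, translation_subgroup H -> translations `<=` H -> H = translations.

Definition translation_coset (g : space_group) : set space_group :=
  [set (g * h)%g | h in translations].

Definition point_group : set (set space_group) := range translation_coset.

(* The separable actions kappa |-> g.kappa and k |-> g.k; the last field is
   p_{g.(kappa, k)} = T_g(p_{kappa, k}) with g.(kappa, k) = (g.kappa, g.k). *)
Record separable := Separable {
  vact : space_group -> 'I_(nv C) -> 'I_(nv C);
  zact : space_group -> 'cV[int]_d -> 'cV[int]_d;
  vact1 : vact 1%g = id;
  vactM : forall g h, vact (g * h)%g = vact g \o vact h;
  zact1 : zact 1%g = id;
  zactM : forall g h, zact (g * h)%g = zact g \o zact h;
  separableE : forall g kappa k,
    pt (vact g kappa, zact g k) = g (pt (kappa, k))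
}.

(* g acts on 'I_ne, identified with the translation classes of framework
   edges: the class of f is sent to the class of T_g(f). *)
Definition edge_act (g : space_group) (f : 'I_(ne C)) : 'I_(ne C) :=
  xget f [set f' | exists k, g @` motif_segment f =
                             trans C k @` motif_segment f'].

Definition edge_vec (e : 'I_(ne C)) : 'cV[R]_d :=
  pt (motif_edge e).1 - pt (motif_edge e).2.

Definition exponent (e : 'I_(ne C)) : 'cV[int]_d :=
  (motif_edge e).2.2 - (motif_edge e).1.2.

Definition rigidity_vertex_block (e : 'I_(ne C)) : 'M[R]_(nv C, d) :=
  let kappa := (motif_edge e).1.1 in
  let tau := (motif_edge e).2.1 in
  \matrix_(i, r) if kappa == tau then 0
                 else if i == kappa then edge_vec e r 0
                 else if i == tau then - edge_vec e r 0
                 else 0.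

Definition rigidity_affine_block (e : 'I_(ne C)) : 'M[R]_d :=
  \matrix_(j, r) ((exponent e j 0)%:~R * edge_vec e r 0).

(* mxvec lists the rows of its argument one after the other. *)
Definition rigidity_mx : 'M[R]_(ne C, nv C * d + d * d) :=
  \matrix_e row_mx (mxvec (rigidity_vertex_block e))
                   (mxvec (rigidity_affine_block e)).

(* In a pair (u, A), column kappa of u is the vector u_kappa. *)
Definition vm_vec (x : 'M[R]_(d, nv C) * 'M[R]_d) :
    'cV[R]_(nv C * d + d * d) :=
  (row_mx (mxvec x.1^T) (mxvec (x.2 *m period_mx (trans C))^T))^T.

(* R(M, R^{d^2}) acting on vector-matrix data. *)
Definition rigidity (x : 'M[R]_(d, nv C) * 'M[R]_d) : 'cV[R]_(ne C) :=
  rigidity_mx *m vm_vec x.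

(* R(M, E). *)
Definition rigidity_res (E : {vspace 'M[R]_d})
    (x : 'M[R]_(d, nv C) * subvs_of E) : 'cV[R]_(ne C) :=
  rigidity (x.1, vsval x.2).

Section Representations.
Variable S : separable.

(* The inclusion i of the point group: the representative with g.0 = 0. *)
Definition pt_incl (gd : set space_group) : space_group :=
  xget 1%g [set g | gd g /\ zact S g 0 = 0].

Definition linear_origin : Prop :=
  forall gd, point_group gd -> linear (iso (pt_incl gd)).

(* The matrix of T_gd. *)
Definition pt_mx (gd : set space_group) : 'M[R]_d := mx_of (pt_incl gd).

Definition pt_conj (gd : set space_group) (A : 'M[R]_d) : 'M[R]_d :=
  pt_mx gd *m A *m invmx (pt_mx gd).

Definition mu_v (gd : set space_group) (u : 'M[R]_(d, nv C)) :
    'M[R]_(d, nv C) :=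
  \matrix_(r, kappa)
    (pt_mx gd *m col (vact S (pt_incl gd)^-1%g kappa) u) r 0.

Definition pi_v (gd : set space_group) (x : 'M[R]_(d, nv C) * 'M[R]_d) :
    'M[R]_(d, nv C) * 'M[R]_d :=
  (mu_v gd x.1, pt_conj gd x.2).

Definition pi_e (gd : set space_group) (w : 'cV[R]_(ne C)) : 'cV[R]_(ne C) :=
  \col_f w (edge_act (pt_incl gd)^-1%g f) 0.

Definition conj_invariant (gd : set space_group) (E : {vspace 'M[R]_d}) :
    Prop :=
  forall A, A \in E -> pt_conj gd A \in E.

(* The restriction of pi_v gd to the pairs (u, A) with A in E. *)
Definition pi_v_res (gd : set space_group) (E : {vspace 'M[R]_d})
    (hE : conj_invariant gd E) (x : 'M[R]_(d, nv C) * subvs_of E) :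
    'M[R]_(d, nv C) * subvs_of E :=
  (mu_v gd x.1, Subvs (hE _ (subvsP x.2))).

End Representations.
End Framework.

(* Main.v *)
From HB Require Import structures.
Require Import Defs.
From mathcomp Require Import all_boot all_order all_algebra.
From mathcomp Require Import boolp classical_sets reals.
From mathcomp Require Import ring lra.

(** Vector-matrix data (u, A) describe an affinely periodic velocity field, in
    which the joint p_(kappa, k) moves with velocity u_kappa - A Z k.  The
    entry of R(M, R^(d^2)) (u, A) at a motif edge is the rate of change of half
    the squared length of the edge, that is, the inner product of the edge
    vector with the relative velocity of the two ends ([rigidity_strain]).
    This quantity, [strain] below, makes sense for any two joints, is symmetric
    in them, and is unchanged when both are moved by the same translation in T.
    It therefore depends only on the translation class of an unoriented edge.

    Let g be the symmetry representing a point group element, so that g fixes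
    the cell label 0 and is a linear isometry.  The symmetry equation at an
    edge e splits into two facts.

    Geometrically, the segment T_(g^-1) e is a translate of the motif edge
    g^-1.e.  A segment determines its pair of endpoints, and points determine
    their labels, so the ends of g^-1.e are, up to order and a translation, the
    images under g^-1 of the ends of e.  By the two invariances of the strain,
    the left-hand side is the strain of (u, A) between those images
    ([strain_edge_act]).

    Algebraically, T_g is orthogonal, hence can be moved to the other argument
    of the inner product as T_(g^-1); and as g fixes 0, it permutes the motif
    points and the period lattice separately: T_(g^-1) Z k = Z (g^-1.k)
    ([pt_inclV_period]).  Hence the strain of the transformed data between two
    joints is the strain of (u, A) between their images under g^-1
    ([strain_pi_v]).

    The equation over a matrix space E is the same identity read on pairs with
    A in E. *)

Set Implicit Arguments.
Unset Strict Implicit.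
Unset Printing Implicit Defensive.

Import Order.TTheory GRing.Theory Num.Theory.

Local Open Scope classical_set_scope.
Local Open Scope ring_scope.

(** * Orthogonal matrices of linear isometries *)

Section DotProduct.
Variables (R : realType) (d : nat).
Implicit Types (x y z : 'cV[R]_d) (f : 'cV[R]_d -> 'cV[R]_d) (M : 'M[R]_d).

Lemma dotC x y : dot x y = dot y x.
Proof. by rewrite /dot !mxE; apply: eq_bigr => i _; rewrite !mxE mulrC. Qed.

Lemma dotDl x y z : dot (x + y) z = dot x z + dot y z.
Proof. by rewrite /dot linearD /= mulmxDl mxE. Qed.

Lemma dotDr x y z : dot x (y + z) = dot x y + dot x z.
Proof. by rewrite dotC dotDl !(dotC x). Qed.

Lemma dotNl x y : dot (- x) y = - dot x y.
Proof. by rewrite /dot linearN /= mulNmx mxE. Qed.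

Lemma dotNN x y : dot (- x) (- y) = dot x y.
Proof. by rewrite dotNl dotC dotNl dotC opprK. Qed.

Lemma dot_mulmx M x y : dot x (M *m y) = dot (M^T *m x) y.
Proof. by rewrite /dot trmx_mul trmxK mulmxA. Qed.

Lemma dot_ge0 x : 0 <= dot x x.
Proof. by rewrite /dot mxE sumr_ge0// => i _; rewrite mxE -expr2 sqr_ge0. Qed.

Lemma mx_ofE f : linear f -> forall x, f x = mx_of f *m x.
Proof.
move=> fL; pose fA := GRing.isLinear.Build R _ _ _ f fL.
pose F : {linear 'cV[R]_d -> 'cV[R]_d} := HB.pack f fA.
move=> x; rewrite -[f]/(F : _ -> _).
have -> : x = \sum_i x i 0 *: delta_mx i 0.
  by rewrite [LHS]matrix_sum_delta; apply: eq_bigr => i _; rewrite big_ord1.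
rewrite linear_sum mulmx_sumr; apply: eq_bigr => i _.
rewrite linearZ /= -scalemxAr -colE; congr (_ *: _).
by apply/colP => r; rewrite !mxE.
Qed.

(** Preservation of distances to the origin gives preservation of squared
    norms, and polarization turns this into preservation of inner products. *)
Lemma isometry_mx_orthogonal f : linear f -> Defs.isometry f ->
  (mx_of f)^T *m mx_of f = 1%:M.
Proof.
move=> fL [fd _]; have fE := mx_ofE fL; set P := mx_of f in fE *.
have sq z : dot (P *m z) (P *m z) = dot z z.
  have := fd z 0; rewrite /dist !fE mulmx0 !subr0 => /eqP.
  by rewrite eqr_sqrt ?dot_ge0// => /eqP.
have polar x y : dot (P *m x) (P *m y) = dot x y.
  have := sq (x + y); rewrite mulmxDr !dotDl !dotDr !sq.
  rewrite (dotC (P *m y)) (dotC y) => h; lra.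
apply/matrixP => i j.
have entryE (M : 'M[R]_d) : M i j = dot (delta_mx i 0) (M *m delta_mx j 0).
  by rewrite /dot trmx_delta -rowE -colE !mxE.
by rewrite !entryE mul1mx -[RHS]polar -mulmxA dot_mulmx trmxK.
Qed.

End DotProduct.

(** * Segments and their endpoints *)

Section Segments.
Variables (R : realType) (d : nat).
Implicit Types (a b c e : 'cV[R]_d).

Lemma segmentP a b z :
  segment a b z <-> exists s : R, 0 <= s <= 1 /\ z = a + s *: (b - a).
Proof.
have E s : (1 - s) *: a + s *: b = a + s *: (b - a).
  by rewrite scalerBl scale1r scalerBr addrAC addrA.
by split=> -[s [s01 ->]]; exists s; rewrite E.
Qed.

Lemma segmentL a b : segment a b a.
Proof. by apply/segmentP; exists 0; rewrite lexx ler01 scale0r addr0. Qed.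

Lemma segmentC a b : segment a b = segment b a.
Proof.
by apply/seteqP; split=> z [s [/andP[s0 s1] ->]]; exists (1 - s);
  rewrite subr_ge0 s1 gerBl s0 subKr [RHS]addrC.
Qed.

Lemma segmentR a b : segment a b b.
Proof. by rewrite segmentC; apply: segmentL. Qed.

(** An endpoint is an extreme point: if a were strictly between c and e, both
    of which lie on the ray from a towards b, then both would equal a. *)
Lemma segment_endpoint a b c e :
  segment a b = segment c e -> a = c \/ a = e.
Proof.
move=> E.
have /segmentP[s [/andP[s0 s1] aE]] : segment c e a by rewrite -E; apply: segmentL.
have /segmentP[p [/andP[p0 _] cE]] : segment a b c by rewrite E; apply: segmentL.
have /segmentP[q [/andP[q0 _] eE]] : segment a b e by rewrite E; apply: segmentR.
have [s00|sN0] := eqVneq s 0; first by left; rewrite aE s00 scale0r addr0.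
have [s10|sN1] := eqVneq s 1; first by right; rewrite aE s10 scale1r addrC subrK.
(* With w = b - a, c = a + p w and e = a + q w, the point
   a = (1 - s) c + s e is a + ((1 - s) p + s q) w. *)
left; have : ((1 - s) * p + s * q) *: (b - a) = 0.
  apply: (addrI a); rewrite addr0 [RHS]aE cE eE.
  move: (b - a) => w; apply/colP => i; rewrite !mxE; ring.
move/eqP; rewrite scaler_eq0 => /orP[/eqP h|/eqP ba0]; last first.
  by rewrite cE ba0 scaler0 addr0.
have sgt0 : 0 < s by rewrite lt_neqAle eq_sym sN0.
have slt1 : s < 1 by rewrite lt_neqAle sN1.
have p00 : p = 0 by nra.
by rewrite cE p00 scale0r addr0.
Qed.

Lemma segment_inj a b c : segment a b = segment a c -> b = c.
Proof.
rewrite segmentC => E; have [ba|//] := segment_endpoint E.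
move: E; rewrite ba [RHS]segmentC => /esym /segment_endpoint.
by case=> ->.
Qed.

Lemma segment_endpoints a b c e : segment a b = segment c e ->
  (a = c /\ b = e) \/ (a = e /\ b = c).
Proof.
move=> E; case: (segment_endpoint E) => aE; subst a; [left|right]; split=> //.
  exact: segment_inj E.
by apply: (@segment_inj e); rewrite E segmentC.
Qed.

Lemma image_segment (f : 'cV[R]_d -> 'cV[R]_d) a b :
  (forall s : R, f ((1 - s) *: a + s *: b) = (1 - s) *: f a + s *: f b) ->
  f @` segment a b = segment (f a) (f b).
Proof.
move=> fE; apply/seteqP; split=> [_ [_ [s [s01 ->]] <-]|_ [s [s01 ->]]].
  by exists s.
by exists ((1 - s) *: a + s *: b) => //; exists s.
Qed.

End Segments.

(** * Translations by periods *)

Section Periods.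
Variables (R : realType) (d : nat) (T : translation_group R d).

Lemma trE k x : T k x = x + T k 0.
Proof. by have [b Tb] := tr_translation T k; rewrite !Tb add0r. Qed.

Lemma tr0D k l : T (k + l) 0 = T k 0 + T l 0.
Proof. by rewrite trD /= trE addrC. Qed.

Lemma tr00 : T 0 0 = 0.
Proof. by apply: (addrI (T 0 0)); rewrite -tr0D !addr0. Qed.

Lemma tr0B k l : T (k - l) 0 = T k 0 - T l 0.
Proof. by apply: (addIr (T l 0)); rewrite -tr0D !subrK. Qed.

(** The map k |-> T_k 0 is additive, hence determined by its values on the
    standard basis, which are the columns of Z. *)
Lemma period_mxE k : period_mx T *m map_mx intr k = T k 0.
Proof.
pose f k := T k 0.
pose fA := GRing.isZmodMorphism.Build _ _ f tr0B.
pose F : {additive 'cV[int]_d -> 'cV[R]_d} := HB.pack f fA.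
have kE : k = \sum_i delta_mx i 0 *~ k i 0.
  rewrite [LHS]matrix_sum_delta; apply: eq_bigr => i _; rewrite big_ord1.
  by apply/matrixP => r c; rewrite -scaler_int !mxE intz.
rewrite -[RHS]/(F k) [in RHS]kE raddf_sum; apply/colP => r.
rewrite mxE summxE; apply: eq_bigr => i _.
by rewrite raddfMz -scaler_int !mxE mulrC.
Qed.

Lemma image_tr_segment k a b :
  T k @` segment a b = segment (T k a) (T k b).
Proof.
apply: image_segment => s; rewrite trE (trE k a) (trE k b).
by apply/colP => i; rewrite !mxE; ring.
Qed.

End Periods.

(** * The strain between two joints *)

Section Strain.
Variables (R : realType) (d : nat) (C : crystal_framework R d).
Implicit Types (v w : label C) (x : 'M[R]_(d, nv C) * 'M[R]_d).

(** The inner product of p_v - p_w with the relative velocity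
    (u_v - A Z k) - (u_w - A Z l), where k and l are the cells of v and w. *)
Definition strain x v w : R :=
  dot (pt v - pt w)
      (col v.1 x.1 - col w.1 x.1 + x.2 *m trans C (w.2 - v.2) 0).

(** Both blocks of a row of the rigidity matrix have rank one, with v_e as right
    factor; the left factor of the vertex block is the difference of two basis
    vectors, which also covers the zero block of the case kappa = tau.  The row
    therefore pairs v_e with one combined velocity vector. *)
Lemma rigidity_strain x e :
  rigidity x e 0 = strain x (motif_edge e).1 (motif_edge e).2.
Proof.
set v := (motif_edge e).1; set w := (motif_edge e).2.
pose a : 'rV[R]_(nv C) := delta_mx 0 v.1 - delta_mx 0 w.1.
have Va : rigidity_vertex_block e = a^T *m (edge_vec e)^T.
  apply/matrixP => i r; rewrite !mxE big_ord1 !mxE eqxx -/v -/w.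
  have [->|vw] := eqVneq v.1 w.1; first by rewrite subrr mul0r.
  have [->|iv] := eqVneq i v.1; first by rewrite (negbTE vw) subr0 mul1r.
  by have [iw|iw] := eqVneq i w.1; rewrite sub0r ?mulN1r// oppr0 mul0r.
have Ba : rigidity_affine_block e =
    ((map_mx intr (exponent e))^T)^T *m (edge_vec e)^T.
  by apply/matrixP => i r; rewrite !mxE big_ord1 !mxE.
have -> : rigidity x e 0 = (row e (rigidity_mx C) *m vm_vec x) 0 0.
  by rewrite -row_mul [in RHS]mxE.
rewrite rowK /vm_vec tr_row_mx mul_row_col Va Ba !mxvec_dotmul trmxK.
rewrite /strain dotC /dot -mulmxDl -!trmx_mul; congr ((_ *m _) 0 0).
rewrite -mulmxA period_mxE -[a]trmxK -trmx_mul -linearD /=; congr (trmx (_ + _)).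
by rewrite /a linearB /= !trmx_delta mulmxBr -!colE.
Qed.

Lemma strainC x v w : strain x v w = strain x w v.
Proof.
rewrite /strain -dotNN opprB; congr dot.
by rewrite opprD opprB -mulmxN !tr0B opprB.
Qed.

Lemma pt0 v : pt v = motif_pt v.1 + trans C v.2 0.
Proof. exact: trE. Qed.

Lemma tr_pt v k : trans C k (pt v) = pt (v.1, v.2 + k).
Proof. by rewrite /pt /= [v.2 + k]addrC trD. Qed.

Lemma strain_tr x v w k :
  strain x (v.1, v.2 + k) (w.1, w.2 + k) = strain x v w.
Proof.
rewrite /strain -(tr_pt v) -(tr_pt w) (trE _ k (pt v)) (trE _ k (pt w)) /=.
congr dot; first by rewrite opprD addrACA subrr addr0.
by rewrite opprD addrACA subrr addr0.
Qed.

End Strain.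

(** * Symmetries acting on joints and edge classes *)

Section Symmetry.
Variables (R : realType) (d : nat) (C : crystal_framework R d).
Variable S : separable C.
Implicit Types (v w : label C) (x : 'M[R]_(d, nv C) * 'M[R]_d).
Implicit Types g : space_group C.

Definition label_act g v : label C := (vact S g v.1, zact S g v.2).

Lemma pt_label_act g v : pt (label_act g v) = g (pt v).
Proof. by rewrite separableE; case: v. Qed.

(** The default value of the choice of a representative is the identity, which
    also fixes the cell 0. *)
Lemma zact_pt_incl gd : zact S (pt_incl S gd) 0 = 0.
Proof. by rewrite /pt_incl; case: xgetP => [g _ []|_] //; rewrite zact1. Qed.

Lemma zactV0 g : zact S g 0 = 0 -> zact S g^-1%g 0 = 0.
Proof.
move=> g0; have := zactM S g^-1%g g.
by rewrite mulVg zact1 => /(congr1 (fun h => h 0)) /=; rewrite g0.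
Qed.

Lemma space_groupK g : cancel (iso g^-1%g) (iso g).
Proof.
by move=> y; have := congr1 (fun h => iso h y) (mulgV g).
Qed.

(** A symmetry sends a motif edge to a framework edge, so the choice defining
    its edge class is made in a nonempty set. *)
Lemma edge_actP g e : exists k,
  g @` motif_segment e = trans C k @` motif_segment (edge_act g e).
Proof.
have [_ _ gE] := asboolW (isoP g).
have : framework_edges C (g @` motif_segment e).
  rewrite -gE; exists (motif_segment e) => //; exists 0, e.
  by rewrite -[LHS]image_id; apply: eq_imagel => y _; rewrite trE tr00 addr0.
move=> [k [e' ee']].
rewrite /edge_act; case: xgetP => [f _ //|noclass].
by case: (noclass e'); exists k.
Qed.

(** The edge class action is defined through segments, hence loses the
    orientation and the cell of an edge; symmetry and translation invariance
    of the strain make up for this. *)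
Lemma strain_edge_act g x e :
  linear (iso g) ->
  strain x (motif_edge (edge_act g e)).1 (motif_edge (edge_act g e)).2 =
  strain x (label_act g (motif_edge e).1) (label_act g (motif_edge e).2).
Proof.
move=> gL; have [k] := edge_actP g e; set e' := edge_act g e.
rewrite image_tr_segment image_segment; last first.
  by move=> s; rewrite !(mx_ofE gL) mulmxDr !scalemxAr.
rewrite -!pt_label_act !tr_pt => /segment_endpoints.
have ptI : injective (@pt _ _ C) := @points_disjoint _ _ C.
case=> -[/ptI -> /ptI ->]; rewrite strain_tr // strainC//.
Qed.

End Symmetry.

(** * The symmetry equation *)

Section Equivariance.
Variables (R : realType) (d : nat) (C : crystal_framework R d).
Variable S : separable C.
Variable gd : set (space_group C).
Hypothesis gL : linear (iso (pt_incl S gd)).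

Let g := pt_incl S gd.
Let P := pt_mx S gd.

Lemma pt_mx_orthogonal : P^T *m P = 1%:M.
Proof.
by have [gI _ _] := asboolW (isoP g); apply: isometry_mx_orthogonal gL gI.
Qed.

Lemma invmx_pt_mx : invmx P = P^T.
Proof.
have [_ Pu] := mulmx1_unit pt_mx_orthogonal.
by rewrite -[LHS]mul1mx -pt_mx_orthogonal mulmxK.
Qed.

Lemma pt_inclV y : iso g^-1%g y = P^T *m y.
Proof.
rewrite -[y in RHS](space_groupK g) (mx_ofE gL) -/P.
by rewrite mulmxA pt_mx_orthogonal mul1mx.
Qed.

Lemma pt_inclV_linear : linear (iso g^-1%g).
Proof. by move=> a y z; rewrite !pt_inclV mulmxDr scalemxAr. Qed.

(** Apply g^-1 to p_(kappa, k) = p_(kappa, 0) + Z k: since g^-1 fixes the cell 0,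
    the first term goes to p_(g^-1.kappa, 0), and separability gives the
    image p_(g^-1.kappa, 0) + Z (g^-1.k) of the sum.  The vertex kappa is there
    because the argument needs some joint in each cell. *)
Lemma pt_inclV_period (kappa : 'I_(nv C)) k :
  P^T *m trans C k 0 = trans C (zact S g^-1%g k) 0.
Proof.
have act l := pt_label_act S g^-1%g (kappa, l).
have := act k; have := act 0.
rewrite !pt_inclV !pt0 /= (zactV0 (zact_pt_incl S gd)) tr00 !addr0 => ->.
by rewrite mulmxDr => /addrI.
Qed.

(** The relative velocity of the transformed data is T_g times a vector; moving
    T_g across the inner product turns it into T_(g^-1) on the edge vector,
    while T_(g^-1) on the right of A acts on periods as the cell action. *)
Lemma strain_pi_v x v w :
  strain (pi_v S gd x) v w =
  strain x (label_act S g^-1%g v) (label_act S g^-1%g w).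
Proof.
have colE kappa : col kappa (mu_v S gd x.1) =
    P *m col (vact S g^-1%g kappa) x.1.
  by apply/colP => r; rewrite !mxE.
rewrite /strain !pt_label_act !pt_inclV /= !colE /pt_conj invmx_pt_mx.
rewrite -2!mulmxA -mulmxBr -mulmxDr dot_mulmx mulmxBr.
by rewrite !tr0B mulmxBr !(pt_inclV_period v.1).
Qed.

Lemma pi_e_rigidity x : pi_e S gd (rigidity x) = rigidity (pi_v S gd x).
Proof.
apply/colP => e; rewrite mxE !rigidity_strain strain_pi_v.
exact: strain_edge_act pt_inclV_linear.
Qed.

End Equivariance.

Theorem theorem3p4 (R : realType) (d : nat) (C : crystal_framework R d)
    (hT : maximal_translations C) (S : separable C) (h0 : linear_origin S) :
  (forall gd : set (space_group C), point_group gd ->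
     forall x : 'M[R]_(d, nv C) * 'M[R]_d,
       pi_e S gd (rigidity x) = rigidity (pi_v S gd x)) /\
  (forall gd : set (space_group C), point_group gd ->
     forall (E : {vspace 'M[R]_d}) (hE : conj_invariant S gd E)
            (x : 'M[R]_(d, nv C) * subvs_of E),
       pi_e S gd (rigidity_res x) = rigidity_res (pi_v_res hE x)).
Proof.
split=> gd gdP => [x|E hE x]; first exact: pi_e_rigidity (h0 _ gdP) x.
exact: pi_e_rigidity (h0 _ gdP) (x.1, vsval x.2).
Qed.
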